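(* Let $P$ be a finite poset and $\mathcal{A}(P)$ the set of antichains of $P$. If $P$ is the disjoint union of two posets $P=P_1+P_2$, then $T(\mathcal{A}(P))\cong T(\mathcal{A}(P_1))\times T(\mathcal{A}(P_2))$. If $P$ is not the disjoint union of two nonempty posets, then $\mathcal{A}(P)$ is toggle-alternating.
   Context: An antichain in a poset $P$ is a set of mutually incomparable elements (the empty set and singletons are antichains). $\mathcal{A}(P)\subseteq 2^P$ is the set of antichains, with ground set $P$. The disjoint union $P_1+P_2$ is the poset on the disjoint union of the ground sets in which elements of $P_1$ are incomparable to elements of $P_2$ and each $P_i$ keeps its order. For a finite set $E$ and $\mathcal{L}\subseteq 2^E$, the toggle of $e\in E$ is the map $t_e:\mathcal{L}\to\mathcal{L}$ with $t_e(X)=X\cup\{e\}$ if $e\notin X$ and $X\cup\{e\}\in\mathcal{L}$; $t_e(X)=X\setminus\{e\}$ if $e\in X$ and $X\setminus\{e\}\in\mathcal{L}$; and $t_e(X)=X$ otherwise. The toggle group $T(\mathcal{L})$ is the subgroup of the symmetric group $\mathfrak{S}_{\mathcal{L}}$ generated by $\{t_e\mid e\in E\}$. $\mathcal{L}$ is toggle-alternating if $T(\mathcal{L})$ contains the alternating group $A_{\mathcal{L}}$. *)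

(* Defs.v *)
From HB Require Import structures.
From mathcomp Require Import all_boot all_order all_fingroup all_solvable.

Set Implicit Arguments.
Unset Strict Implicit.
Unset Printing Implicit Defensive.

Section Toggle.
Variables (E : finType) (L : {set {set E}}).

(* L as a finite type of its own, so that the symmetric group on L is
   {perm members}. *)
Local Notation members := {X : {set E} | X \in L}.

Definition toggle_set (e : E) (X : {set E}) : {set E} :=
  if (e \notin X) && (e |: X \in L) then e |: X
  else if (e \in X) && (X :\ e \in L) then X :\ e
  else X.

Lemma toggle_set_in e X : X \in L -> toggle_set e X \in L.
Proof. by rewrite /toggle_set => XL; do 2?case: ifP => [/andP[]|_]. Qed.

Lemma toggle_setK e X : X \in L -> toggle_set e (toggle_set e X) = X.
Proof.
move=> XL; rewrite {2}/toggle_set.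
case: ifP => [/andP[eX eXL]|h1].
  by rewrite /toggle_set setU11 /= setU1K // XL.
case: ifP => [/andP[eX eXL]|h2]; last by rewrite /toggle_set h1 h2.
by rewrite /toggle_set !inE eqxx /= setD1K // XL.
Qed.

Definition toggle_fun (e : E) (X : members) : members :=
  exist _ (toggle_set e (val X)) (toggle_set_in e (valP X)).

Lemma toggle_fun_inj e : injective (toggle_fun e).
Proof.
by apply: (@inv_inj _ (toggle_fun e)) => X; apply/val_inj/toggle_setK/valP.
Qed.

Definition toggle (e : E) : {perm members} := perm (@toggle_fun_inj e).

Definition toggle_group : {group {perm members}} :=
  <<[set toggle e | e : E]>>%G.

Definition toggle_alternating : bool :=
  ('Alt_members \subset toggle_group)%g.

End Toggle.

Definition antichains d (P : finPOrderType d) : {set {set P}} :=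
  [set A : {set P} |
    [forall x in A, forall y in A, (x != y) ==> (x >< y)%O]].

Fact dunion_display (d1 d2 : Order.disp_t) : Order.disp_t.
Proof. exact: Order.Disp tt tt. Qed.

Definition dunion d1 d2 (P1 : finPOrderType d1) (P2 : finPOrderType d2) : Type :=
  (P1 + P2)%type.

Section DisjointUnion.
Variables (d1 d2 : Order.disp_t).
Variables (P1 : finPOrderType d1) (P2 : finPOrderType d2).

HB.instance Definition _ := Finite.on (dunion P1 P2).

Definition dunion_le (u v : dunion P1 P2) : bool :=
  match u, v with
  | inl x, inl y => (x <= y)%O
  | inr x, inr y => (x <= y)%O
  | _, _ => false
  end.

Fact dunion_le_refl : reflexive dunion_le.
Proof. by case=> x; apply: Order.le_refl. Qed.

Fact dunion_le_anti : antisymmetric dunion_le.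
Proof. by case=> x [] y //= /Order.le_anti ->. Qed.

Fact dunion_le_trans : transitive dunion_le.
Proof. by case=> y [] x [] z //=; apply: Order.le_trans. Qed.

HB.instance Definition _ :=
  Order.Le_isPOrder.Build (dunion_display d1 d2) (dunion P1 P2)
    dunion_le_refl dunion_le_anti dunion_le_trans.

End DisjointUnion.

Definition order_isomorphic d d' (P : finPOrderType d) (Q : finPOrderType d') :
    Prop :=
  exists f : P -> Q, bijective f /\ {mono f : x y / (x <= y)%O}.

Definition is_disjoint_union d d1 d2 (P : finPOrderType d)
    (P1 : finPOrderType d1) (P2 : finPOrderType d2) : Prop :=
  order_isomorphic P (dunion P1 P2).

(* Main.v *)
(* Antichains are the independent sets of the comparability graph, and P is not
   a disjoint union exactly when that graph is connected. For a connected graph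
   we grow a vertex set V from one edge, keeping every vertex of V adjacent to
   another one, and show inductively that the toggle group of the independent
   sets in V contains the alternating group. When v is added to V', pick w in V'
   adjacent to v and u in V' adjacent to w: the toggle t of w swaps {} and {w},
   and fixes {u} and every set containing v. If h acts on the independent sets in
   V' as the 3-cycle ({} {w} {u}), then t^h t is exactly that 3-cycle, with no
   effect on the sets containing v. Conjugation then produces enough 3-cycles.
   For a disjoint union, antichains are pairs of antichains and each toggle moves
   only one component. *)
From HB Require Import structures.
Require Import Defs.
From mathcomp Require Import all_boot all_order all_fingroup all_solvable.

Set Implicit Arguments.
Unset Strict Implicit.
Unset Printing Implicit Defensive.

(** * Three-cycles and generation of the alternating group *)

Section ThreeCycles.
Local Open Scope group_scope.
Variable T : finType.
Implicit Types (a b c x y : T) (s t : {perm T}) (G : {group {perm T}}).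

(** Products of permutations apply the left factor first, so for distinct points this is the cycle
    sending [a] to [b], [b] to [c] and [c] to [a]. *)
Definition cyc3 a b c : {perm T} := tperm a b * tperm a c.

Lemma cyc3J a b c s : cyc3 a b c ^ s = cyc3 (s a) (s b) (s c).
Proof. by rewrite /cyc3 conjMg !tpermJ. Qed.

Lemma cyc3V a b c : (cyc3 a b c)^-1 = cyc3 a c b.
Proof. by rewrite /cyc3 invMg !tpermV. Qed.

Lemma cyc3_1 a b c : b != a -> b != c -> cyc3 a b c a = b.
Proof. by move=> ba bc; rewrite permM tpermL tpermD // eq_sym. Qed.

Lemma cyc3_2 a b c : cyc3 a b c b = c.
Proof. by rewrite permM tpermR tpermL. Qed.

Lemma cyc3_3 a b c : c != a -> c != b -> cyc3 a b c c = a.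
Proof.
by move=> ca cb; rewrite permM [tperm a b c]tpermD 1?eq_sym // tpermR.
Qed.

Lemma cyc3_out a b c x : x != a -> x != b -> x != c -> cyc3 a b c x = x.
Proof. by move=> xa xb xc; rewrite permM !tpermD // eq_sym. Qed.

Lemma cyc3_rot a b c : b != c -> a != c -> cyc3 a b c = cyc3 b c a.
Proof.
move=> bc ac; rewrite /cyc3 [RHS]conjgC tpermJ_tperm ?[tperm b a]tpermC //.
Qed.

Lemma cyc3_swap a b c : a != b -> a != c -> b != c ->
  cyc3 b a c = (cyc3 a b c)^-1.
Proof.
by move=> ab ac bc; rewrite cyc3V cyc3_rot // ?[cyc3 a c b]cyc3_rot // eq_sym.
Qed.

Lemma even_cyc3 a b c : a != b -> a != c -> cyc3 a b c \in 'Alt_T.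
Proof. by move=> ab ac; rewrite Alt_even odd_permM !odd_tperm ab ac. Qed.

(* The 3-cycles through [a] and [b] generate a group normalised by [(a b)]; its
   product with [<[(a b)]>] contains all [(a x)], so it has index at most 2. *)
Lemma Alt_of_cyc3 G a b : a != b ->
  (forall x, x != a -> x != b -> cyc3 a b x \in G) -> 'Alt_T \subset G.
Proof.
move=> ab cG; pose A := [set cyc3 a b x | x in ~: [set a; b]].
have AP x : x != a -> x != b -> cyc3 a b x \in <<A>>.
  by move=> xa xb; rewrite mem_gen // imset_f // !inE negb_or xa.
have Aind (H : {set {perm T}}) :
    (forall x, x != a -> x != b -> cyc3 a b x \in H) -> A \subset H.
  move=> cH; apply/subsetP=> _ /imsetP[x xab ->].
  by move: xab; rewrite inE !in_set2 negb_or => /andP[]; apply: cH.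
have sAG : <<A>> \subset G by rewrite gen_subG Aind.
have sAAlt : <<A>> \subset 'Alt_T.
  by rewrite gen_subG Aind // => x xa xb; rewrite even_cyc3 // eq_sym.
have nA : <[tperm a b]> \subset 'N(<<A>>).
  rewrite cycle_subG inE sub_conjg gen_subG Aind // => x xa xb.
  rewrite mem_conjgV cyc3J tpermL tpermR [tperm a b x]tpermD 1?eq_sym //.
  by rewrite cyc3_swap 1?[_ == x]eq_sym // groupV AP.
have full : <<A>> * <[tperm a b]> = [set: {perm T}].
  apply/eqP; rewrite -norm_joinEr // eqEsubset subsetT -(gen_tperm a) gen_subG.
  apply/subsetP=> _ /imsetP[x _ ->].
  have tN : tperm a b \in <<A>> <*> <[tperm a b]>.
    by rewrite mem_gen // inE cycle_id orbT.
  have [->|xb] := eqVneq x b; first exact: tN.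
  have [->|xa] := eqVneq x a; first by rewrite tperm1 group1.
  (* Here (a x) = (a b) ((a b) (a x)), and the second factor is [cyc3 a b x]. *)
  rewrite -[tperm a x](tpermKg a b) groupM //.
  by rewrite mem_gen // inE AP.
apply/subsetP=> s sAlt; have : s \in <<A>> * <[tperm a b]> by rewrite full inE.
case/mulsgP=> g h gA /cycleP[i ->] Ds; move: sAlt; rewrite Ds.
(* If the power is (a b) itself, the even [g] times (a b) is odd, against [sAlt]. *)
have [->|->] : tperm a b ^+ i = 1 \/ tperm a b ^+ i = tperm a b.
- elim: i {Ds} => [|i [] IH]; first by left.
    by right; rewrite expgS IH mulg1.
  by left; rewrite expgS IH tperm2.
- by rewrite mulg1 => _; apply: (subsetP sAG).
have := subsetP sAAlt _ gA.
by rewrite !Alt_even odd_permM odd_tperm ab => /negPf->.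
Qed.

(* [t] carries [S] onto a set that covers the complement of [S] and meets [S]
   in at least [b]; 3-cycles of both sets sharing a point give all the others. *)
Lemma Alt_of_involution G (S : {set T}) t a b c :
    a != b -> c != a -> c != b -> a \in S -> b \in S -> c \in S ->
    (forall x, x \in S -> x != a -> x != b -> cyc3 a b x \in G) ->
    t \in G -> involutive t -> t b = b -> t a \notin S ->
    (forall x, x \notin S -> t x \in S) ->
  'Alt_T \subset G.
Proof.
move=> ab ca cb aS bS cS cG tG tK tb taS tS.
have nS x y : x \in S -> y \notin S -> x != y.
  by move=> xS; apply: contraNneq => <-.
have eqt x y : (t x == t y) = (x == y) by rewrite (inj_eq perm_inj).
have ab' : t a != b by rewrite eq_sym nS.
have aa' : a != t a by rewrite nS.
have ba : b != a by rewrite eq_sym.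
have a'a : t a != a by rewrite eq_sym.
have ba' : b != t a by rewrite eq_sym.
(* The one 3-cycle that [t] does not supply directly, since its third point is the image of [a]. It
   is assembled from (t a, b, t c), the conjugate of (a b c) by [t]. *)
have cycta : cyc3 a b (t a) \in G.
  have zG : cyc3 (t a) b (t c) \in G by rewrite -[b]tb -cyc3J groupJ ?tb ?cG.
  have zb : t c != b by rewrite -tb eqt.
  have za' : t c != t a by rewrite eqt.
  have za : t c != a by rewrite -[a]tK eqt; apply: nS.
  have [az bz a'z] : [/\ a != t c, b != t c & t a != t c].
    by rewrite ![_ == t c]eq_sym.
  have [zS|zS] := boolP (t c \in S).
    (* Conjugating (t a, b, t c) by the inverse of (a, b, t c) gives (t a, a, b), a rotation of the
       goal. *)
    have := groupJ zG (groupVr (cG _ zS za zb)).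
    rewrite cyc3J cyc3V [_ (t a)]cyc3_out // [_ b]cyc3_3 // cyc3_2.
    by rewrite cyc3_rot.
  have [ac bc] : a != c /\ b != c by rewrite ![_ == c]eq_sym.
  have zc : t c != c by rewrite eq_sym nS.
  (* The inverse of (a b c) moves only [b] here, to [a], giving (t a, a, t c). Conjugating (t a, b,
     t c) by that cycle yields (a, b, t a). *)
  have := groupJ zG (groupVr (cG _ cS ca cb)).
  rewrite cyc3J cyc3V [_ (t a)]cyc3_out 1?eq_sym ?nS //.
  rewrite [_ b]cyc3_3 // [_ (t c)]cyc3_out // => rG.
  have := groupJ zG rG.
  by rewrite cyc3J cyc3_1 // [_ b]cyc3_out // cyc3_3.
apply: (Alt_of_cyc3 ab) => x xa xb.
have [xS|xS] := boolP (x \in S); first exact: cG.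
have [->//|xa'] := eqVneq x (t a).
have txa : t x != a by rewrite -[a]tK eqt.
have txb : t x != b by rewrite -tb eqt.
have qG : cyc3 (t a) b x \in G.
  by rewrite -[b]tb -[x]tK -cyc3J groupJ ?tb ?cG ?tS.
(* The inverse of (a, b, t a) carries (t a, b, x) to (b, a, x), the inverse of the goal. *)
have := groupJ qG (groupVr cycta).
rewrite cyc3J cyc3V cyc3_2 [cyc3 _ _ _ b]cyc3_3 // cyc3_out //.
by rewrite cyc3_swap 1?[_ == x]eq_sym // groupV.
Qed.
End ThreeCycles.

(** * Elementary facts on toggles *)

Section ToggleTheory.
Variables (E : finType) (L : {set {set E}}).
Local Notation members := {X : {set E} | X \in L}.
Implicit Types (X : members) (e : E).

Lemma val_toggle e X : val (toggle L e X) = toggle_set L e (val X).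
Proof. by rewrite permE. Qed.

Lemma toggleK e : involutive (toggle L e).
Proof.
by move=> X; apply: val_inj; rewrite !val_toggle toggle_setK ?(valP X).
Qed.

Lemma mem_toggle_group e : toggle L e \in toggle_group L.
Proof. by rewrite mem_gen // imset_f. Qed.

Lemma toggle_set_notin e (A : {set E}) z : z != e ->
  (z \in toggle_set L e A) = (z \in A).
Proof.
move=> ze; rewrite /toggle_set.
by do 2?case: ifP => _; rewrite ?inE ?(negPf ze) ?ze.
Qed.

(** Elements of a generated finite group are words in the generators without inverses, so left
    multiplication by a toggle is the only inductive step. *)
Lemma toggle_group_ind (Q : {perm members} -> Prop) :
  Q 1%g -> (forall e g, Q g -> Q (toggle L e * g)%g) ->
  forall g, g \in toggle_group L -> Q g.
Proof.
move=> Q1 QM g /gen_prodgP[n [c cP ->]].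
elim: n c cP => [|n IH] c cP; first by rewrite big_ord0.
rewrite big_ord_recl; have /imsetP[e _ ->] := cP ord0.
by apply/QM/IH.
Qed.

End ToggleTheory.

(** * Independent sets of a graph *)

Section IndependentSets.
Variables (E : finType) (r : rel E).
Hypotheses (r_sym : symmetric r) (r_irr : irreflexive r).
Implicit Types (V A B : {set E}) (v w u e : E).

(** The ground set stays [E] while [V] varies, so that growing [V] changes no vertex type; toggles
    at vertices outside [V] act trivially. *)
Definition indep V : {set {set E}} :=
  [set A : {set E} | (A \subset V) && [forall x in A, forall y in A, ~~ r x y]].

Local Notation members V := {X : {set E} | X \in indep V}.

Lemma indepP V A :
  reflect (A \subset V /\ {in A &, forall x y, ~~ r x y}) (A \in indep V).
Proof.
rewrite inE; apply: (iffP andP) => -[XV rX]; split=> //.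
  by move=> x y xX yX; apply: (forall_inP (forall_inP rX x xX)).
by apply/forall_inP=> x xX; apply/forall_inP=> y yX; apply: rX.
Qed.

Lemma indep_set0 V : set0 \in indep V.
Proof. by apply/indepP; split; [apply: sub0set | move=> x y; rewrite inE]. Qed.

Lemma indep_set1 V v : ([set v] \in indep V) = (v \in V).
Proof.
apply/indepP/idP => [[]|vV]; first by rewrite sub1set.
by split=> [|x y /set1P-> /set1P->]; rewrite ?sub1set ?r_irr.
Qed.

Lemma indep_sub V A B : B \subset A -> A \in indep V -> B \in indep V.
Proof.
move=> YX /indepP[XV rX]; apply/indepP; split; first exact: subset_trans XV.
by apply: sub_in2 rX; apply/subsetP.
Qed.

Lemma indep_restrict V V' A : V' \subset V ->
  (A \in indep V') = (A \subset V') && (A \in indep V).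
Proof.
move=> sV; rewrite !inE; have [XV'|//] := boolP (A \subset V').
by rewrite (subset_trans XV' sV).
Qed.

Lemma toggle_set_indep V e A : A \in indep V ->
  toggle_set (indep V) e A =
    if e \in A then A :\ e else if e |: A \in indep V then e |: A else A.
Proof.
move=> XV; rewrite /toggle_set; have [eX|eX] //= := boolP (e \in A).
by rewrite (indep_sub (subD1set _ _) XV).
Qed.

Lemma toggle_set_adj V w v A : r w v -> v \in A -> A \in indep V ->
  toggle_set (indep V) w A = A.
Proof.
move=> wv vX XV; rewrite toggle_set_indep //.
have wX : w \notin A.
  by case/indepP: XV => _ rX; apply: contraL wv => wX; apply: rX.
rewrite (negPf wX); case: ifP => // /indepP[_ /(_ w v)].
by rewrite !inE eqxx vX orbT wv => /(_ isT isT).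
Qed.

Lemma toggle_set_indep0 V w : w \in V -> toggle_set (indep V) w set0 = [set w].
Proof.
by move=> wV; rewrite toggle_set_indep ?indep_set0 // inE setU0 indep_set1 wV.
Qed.

Definition inj_members V V' (sV : V' \subset V) (X : members V') : members V :=
  let XV' := valP X in
  exist _ (val X)
    (proj2 (andP (etrans (esym (indep_restrict (val X) sV)) XV'))).

(** * Adding one vertex to the graph *)

Section Lift.
Variables (V' : {set E}) (v : E).
Hypothesis vV' : v \notin V'.
Let V := v |: V'.
Let sV : V' \subset V := subsetUr _ _.
Local Notation iota := (inj_members sV).
Implicit Types (X : members V') (Y : members V).

Lemma inj_members_inj : injective iota.
Proof. by move=> X Y /(congr1 val) XY; apply: val_inj. Qed.

Lemma mem_inj_members (Y : members V) : v \notin val Y -> exists X, Y = iota X.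
Proof.
case: Y => Y YV /= vY; have YV' : Y \in indep V'.
  rewrite (indep_restrict _ sV) YV andbT; apply/subsetP=> x xY.
  have /indepP[/subsetP/(_ x xY)] := YV.
  by rewrite !inE => /predU1P[xv|//]; rewrite -xv xY in vY.
by exists (exist _ Y YV'); apply: val_inj.
Qed.

Lemma notin_inj_members X : v \notin val (iota X).
Proof. by apply: contra vV'; apply/subsetP; have /indepP[] := valP X. Qed.

(** The word in toggles that spells [g] is read again in the larger family. It never toggles [v], so
    sets with and without [v] are not mixed; its action on sets containing [v] is otherwise
    uncontrolled. *)
Lemma toggle_lift g : g \in toggle_group (indep V') ->
  exists2 h, h \in toggle_group (indep V) &
    (forall X, h (iota X) = iota (g X)) /\
    (forall Y, (v \in val (h Y)) = (v \in val Y)).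
Proof.
move: g; apply: toggle_group_ind => [|e g [h hG [hi hv]]].
  by exists 1%g; rewrite ?group1 //; split=> Z; rewrite !perm1.
have [eV'|eV'] := boolP (e \in V'); last first.
  (* A toggle outside [V'] is the identity on [indep V'] and is dropped from the word. *)
  exists h => //; split=> // X; rewrite hi permM; congr (iota (g _)).
  apply: val_inj; rewrite val_toggle toggle_set_indep ?(valP X) //.
  case: ifP => [eX|_]; last case: ifP => // /indepP[].
    by case/negP: eV'; have /indepP[/subsetP-> //] := valP X.
  by rewrite subUset sub1set (negPf eV').
have ve : v != e by apply: contraNneq vV' => ->.
exists (toggle _ e * h)%g; first by rewrite groupM ?mem_toggle_group.
split=> [X|Y]; last by rewrite permM hv val_toggle toggle_set_notin.
rewrite !permM -hi; congr (h _); apply: val_inj => /=.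
rewrite !val_toggle !toggle_set_indep ?(valP X) ?(valP (iota X)) //=.
case: ifP => // _; rewrite (indep_restrict _ sV) subUset sub1set eV'.
by have /indepP[-> _] := valP X.
Qed.

(** An instance of [Alt_of_involution]: [S] consists of the sets avoiding [v], the involution is the
    toggle of [v], and the three points are the empty set, {w} and {u}. The edge from [w] to [v]
    makes {w} a fixed point of that toggle. *)
Lemma toggle_alternating_extend w u :
    w \in V' -> u \in V' -> r w v -> r w u ->
  toggle_alternating (indep V') -> toggle_alternating (indep V).
Proof.
move=> wV' uV' wv wu /subsetP AltV'.
have w1 : [set w] \in indep V' by rewrite indep_set1.
have u1 : [set u] \in indep V' by rewrite indep_set1.
pose a := exist _ set0 (indep_set0 V') : members V'.
pose b := exist _ [set w] w1 : members V'.
pose c := exist _ [set u] u1 : members V'.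
have uw : u != w by apply: contraTneq wu => ->; rewrite r_irr.
have set10 (x : E) : [set x] != set0 by rewrite -card_gt0 cards1.
have ba : b != a by rewrite -val_eqE set10.
have ca : c != a by rewrite -val_eqE set10.
have cb : c != b by rewrite -val_eqE /= (inj_eq set1_inj).
have [ab ac bc] : [/\ a != b, a != c & b != c].
  by rewrite eq_sym ba eq_sym ca eq_sym cb.
have wV : w \in V by rewrite inE wV' orbT.
have vV : v \in V by rewrite !inE eqxx.
have eqi (X Z : members V') : (iota X == iota Z) = (X == Z).
  by rewrite (inj_eq inj_members_inj).
pose t := toggle (indep V) w; have tK : involutive t := @toggleK _ _ w.
have tv Y : v \in val Y -> t Y = Y.
  by move=> vY; apply: val_inj; rewrite val_toggle (toggle_set_adj wv vY) ?(valP Y).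
have ta : t (iota a) = iota b by apply: val_inj; rewrite val_toggle toggle_set_indep0.
have tb : t (iota b) = iota a by rewrite -ta tK.
have tc : t (iota c) = iota c.
  apply: val_inj; rewrite val_toggle /= (toggle_set_adj wu) ?set11 //.
  by rewrite indep_set1 inE uV' orbT.
have wnv : v != w by apply: contraTneq wv => ->; rewrite r_irr.
have tS Y : (v \in val (t Y)) = (v \in val Y).
  by rewrite val_toggle toggle_set_notin.
have abcG : cyc3 (iota a) (iota b) (iota c) \in toggle_group (indep V).
  have [h hG [hi hv]] := toggle_lift (AltV' _ (even_cyc3 ab ac)).
  suff <- : (t ^ h * t)%g = cyc3 (iota a) (iota b) (iota c).
    by rewrite groupM ?groupJ ?mem_toggle_group.
  (* Every member has the form [h z], and [t ^ h * t] sends it to [t (h (t z))], so the inverse of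
     [h] is never evaluated. *)
  apply/permP=> z; rewrite -(permKV h z); move: (_ z) => {}z.
  rewrite permM permJ.
  have [->|za] := eqVneq z (iota a).
    by rewrite ta !hi cyc3_2 cyc3_1 // tc cyc3_2.
  have [->|zb] := eqVneq z (iota b).
    by rewrite tb !hi cyc3_2 cyc3_1 // tb cyc3_3 ?eqi.
  have [->|zc] := eqVneq z (iota c).
    by rewrite tc !hi cyc3_3 // ta cyc3_1 ?eqi.
  have [tza tzb tzc] : [/\ t z != iota a, t z != iota b & t z != iota c].
    by split; [rewrite -tb | rewrite -ta | rewrite -tc]; rewrite (inj_eq perm_inj).
  have hout x : x != iota a -> x != iota b -> x != iota c ->
      v \notin val x -> h x = x.
    move=> xa xb xc /mem_inj_members[X DX]; rewrite DX !eqi in xa xb xc *.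
    by rewrite hi cyc3_out.
  have [vz|vz] := boolP (v \in val z).
    have vnot X Y : v \in val Y -> Y != iota X.
      by apply: contraTneq => ->; apply: notin_inj_members.
    by rewrite !tv ?hv // cyc3_out // vnot ?hv.
  by rewrite !hout ?tS // tK cyc3_out.
have [ab_i ca_i cb_i] : [/\ iota a != iota b, iota c != iota a & iota c != iota b].
  by rewrite !eqi.
have tva : v \in val (toggle (indep V) v (iota a)).
  by rewrite val_toggle toggle_set_indep0 // inE.
pose S := [set Y : members V | v \notin val Y].
have iotaS X : iota X \in S by rewrite in_set notin_inj_members.
apply: (Alt_of_involution ab_i ca_i cb_i (iotaS a) (iotaS b) (iotaS c) _
         (mem_toggle_group _ v) (@toggleK _ _ v)).
- move=> x /[1!in_set]/mem_inj_members[X ->]; rewrite !eqi => Xa Xb.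
  have [->//|Xc] := eqVneq X c.
  (* The transposition (c X) alone would carry (a b c) to (a b X) but is odd. The factor (a b)
     repairs the parity and only inverts the resulting cycle. *)
  have eg : (tperm a b * tperm c X)%g \in Alt (members V').
    by rewrite Alt_even odd_permM !odd_tperm ab eq_sym Xc.
  have [h hG [hi _]] := toggle_lift (AltV' _ eg).
  have := groupJ abcG hG; rewrite cyc3J !hi !permM tpermL tpermR.
  have [aX bX] : a != X /\ b != X by rewrite ![_ == X]eq_sym.
  by rewrite [tperm a b c]tpermD // tpermL !tpermD // cyc3_swap ?groupV ?eqi.
- apply: val_inj; rewrite val_toggle (@toggle_set_adj _ _ w) ?(valP (iota b)) //=.
    by rewrite r_sym.
  by rewrite set11.
- by rewrite in_set negbK.
move=> x; rewrite !in_set negbK val_toggle toggle_set_indep ?(valP x) // => vx.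
by rewrite vx !inE eqxx.
Qed.

End Lift.

(** Any independent set in [V] other than the empty set and {w} contains a neighbour of [w], which
    blocks the toggle. *)
Lemma toggle_dominating V w (a b : members V) :
    w \in V -> {in V, forall x, x != w -> r w x} ->
    val a = set0 -> val b = [set w] ->
  toggle (indep V) w = tperm a b.
Proof.
move=> wV wdom Da Db; apply/permP=> z; apply: val_inj; rewrite val_toggle.
case: tpermP => [->|->|za zb].
- by rewrite Da Db toggle_set_indep0.
- by rewrite Da Db toggle_set_indep ?indep_set1 // set11 setDv.
have /set0Pn[x xz] : val z != set0.
  by apply: contra_notN za => /eqP z0; apply: val_inj; rewrite z0 Da.
have xV : x \in V by have /indepP[/subsetP->] := valP z.
have [xw|/(wdom x xV) wx] := eqVneq x w; last first.
  by rewrite (toggle_set_adj wx) ?(valP z).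
case: zb; apply: val_inj; rewrite Db; apply/setP=> y; rewrite inE.
apply/idP/eqP=> [yz|->]; last by rewrite -xw.
apply/eqP/negPn/negP=> yw; have /indepP[/subsetP zV rz] := valP z.
by have := wdom y (zV y yz) yw; rewrite -xw (negPf (rz x y xz yz)).
Qed.

(** An edge has only three independent sets, and each endpoint dominates it, so the two toggles are
    transpositions through the empty set; their product is the single 3-cycle that [Alt_of_cyc3]
    asks for. *)
Lemma toggle_alternating_edge v w : r v w -> toggle_alternating (indep [set v; w]).
Proof.
move=> vw; have [vV wV] : v \in [set v; w] /\ w \in [set v; w].
  by rewrite !inE !eqxx orbT.
have v1 : [set v] \in indep [set v; w] by rewrite indep_set1.
have w1 : [set w] \in indep [set v; w] by rewrite indep_set1.
pose a := exist _ set0 (indep_set0 [set v; w]) : members [set v; w].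
pose b := exist _ [set v] v1 : members [set v; w].
pose c := exist _ [set w] w1 : members [set v; w].
have set10 (x : E) : [set x] != set0 by rewrite -card_gt0 cards1.
have ab : a != b by rewrite -val_eqE eq_sym set10.
apply: (Alt_of_cyc3 ab) => x xa xb.
have -> : x = c.
  have /indepP[/subsetP xV rx] := valP x.
  have vx : v \notin val x.
    apply: contra xb => vx; rewrite -val_eqE eqEsubset sub1set vx andbT.
    apply/subsetP=> z zx; have := xV z zx; rewrite !inE => /orP[//|/eqP zw].
    by have := rx v z vx zx; rewrite zw vw.
  have xw z : z \in val x -> z = w.
    move=> zx; have := xV z zx; rewrite !inE => /orP[/eqP zv|/eqP//].
    by have := zx; rewrite zv (negPf vx).
  have /set0Pn[y yx] : val x != set0 by rewrite -val_eqE in xa.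
  apply/val_inj/setP => z; rewrite inE; apply/idP/eqP => [/xw//|->].
  by have := yx; rewrite (xw y yx).
rewrite /cyc3 -(@toggle_dominating _ v) // => [|y].
  rewrite -(@toggle_dominating _ w) // => [|y].
    by rewrite groupM ?mem_toggle_group.
  by rewrite !inE => /orP[/eqP->|->//]; rewrite r_sym.
by rewrite !inE => /orP[->//|/eqP->].
Qed.

(** Connectedness is stated as an edge leaving every proper nonempty vertex set, exactly what is
    needed to enlarge a maximal [good] set. *)
Lemma toggle_alternating_connected :
    (forall V, V != set0 -> V != setT ->
       exists w v, [/\ w \in V, v \notin V & r w v]) ->
  toggle_alternating (indep setT).
Proof.
(* With at most one vertex there is no edge to start from, but at most two independent sets, so the
   alternating group is trivial. *)
move=> conn; have [E1|E2] := leqP #|E| 1.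
  rewrite /toggle_alternating trivial_Alt_2 ?sub1G //.
  rewrite card_sig (leq_trans (max_card _)) // -cardsT -powersetT card_powerset.
  by rewrite cardsT (leq_pexp2l _ E1).
have /card_gt0P[x _] : 0 < #|E| by apply: ltnW.
(* The middle condition supplies the neighbour [u] of [w] inside [V] when a further vertex is
   attached to [w]. *)
pose good V := [&& V != set0, [forall w in V, [exists u in V, r w u]]
                 & toggle_alternating (indep V)].
have [||w [v [/set1P-> _ xv]]] := conn [set x].
- by rewrite -card_gt0 cards1.
- by apply: contraTneq E2 => E2; rewrite -cardsT -E2 cards1.
have /maxset_exists[V /maxsetP[/and3P[V0 Vr VAlt] Vmax] _] : good [set x; v].
  apply/and3P; split; last exact: toggle_alternating_edge.
    by apply/set0Pn; exists x; rewrite !inE eqxx.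
  apply/forall_inP=> w'; rewrite !inE => /orP[]/eqP->; apply/existsP.
    by exists v; rewrite !inE eqxx orbT.
  by exists x; rewrite !inE eqxx r_sym.
have [<-//|VT] := eqVneq V setT.
have [w' [y [wV yV wy]]] := conn V V0 VT.
have /exists_inP[u uV wu] := forall_inP Vr w' wV.
suff /Vmax/(_ (subsetUr _ _))/setP/(_ y) : good (y |: V).
  by rewrite !inE eqxx (negPf yV).
apply/and3P; split; last exact: (toggle_alternating_extend yV wV uV wy wu VAlt).
  by apply/set0Pn; exists y; rewrite !inE eqxx.
apply/forall_inP=> z; rewrite !inE => /predU1P[->|zV]; apply/existsP.
  by exists w'; rewrite !inE wV orbT r_sym.
have /exists_inP[u' u'V zu] := forall_inP Vr z zV.
by exists u'; rewrite !inE u'V orbT.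
Qed.

End IndependentSets.

(** * Product of two permutation groups acting on a product set *)

Section DirectProduct.
Local Open Scope group_scope.
Variables (T1 T2 T : finType) (f : T1 * T2 -> T) (f' : T -> T1 * T2).
Hypotheses (fK : cancel f f') (f'K : cancel f' f).

Definition prod_fun (s : {perm T1} * {perm T2}) (x : T) : T :=
  f (s.1 (f' x).1, s.2 (f' x).2).

Lemma prod_fun_inj s : injective (prod_fun s).
Proof.
move=> x y /(can_inj fK)[/perm_inj e1 /perm_inj e2].
by rewrite -[x]f'K -[y]f'K [f' x]surjective_pairing e1 e2 -surjective_pairing.
Qed.

Definition prod_perm s : {perm T} := perm (@prod_fun_inj s).

Lemma prod_permE s x1 x2 : prod_perm s (f (x1, x2)) = f (s.1 x1, s.2 x2).
Proof. by rewrite permE /prod_fun fK. Qed.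

Lemma prod_permM : {in setT &, {morph prod_perm : s t / s * t}}.
Proof.
move=> s t _ _; apply/permP=> x; rewrite -[x]f'K; case: (f' x) => x1 x2.
by rewrite permM !prod_permE /= !permM.
Qed.

Canonical prod_perm_morphism := Morphism prod_permM.

(** Each component is recovered by fixing the other coordinate, hence a point in each factor: if
    [T2] were empty, all of the permutations of [T1] would act alike. *)
Lemma injm_prod_perm : T1 -> T2 -> 'injm prod_perm.
Proof.
move=> z1 z2; apply/injmP=> s t _ _ st; case: s t st => [s1 s2] [t1 t2] /permP st.
congr (_, _); apply/permP=> x.
  by have := st (f (x, z2)); rewrite !prod_permE => /(can_inj fK)[].
by have := st (f (z1, x)); rewrite !prod_permE => /(can_inj fK)[].
Qed.

(** The direct product is the join of its two factors, and morphisms commute with generation, so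
    generators that move one coordinate suffice. *)
Lemma prod_perm_gen (A1 : {set {perm T1}}) (A2 : {set {perm T2}}) :
  prod_perm @* setX <<A1>> <<A2>> =
    <<[set prod_perm (s, 1) | s in A1] :|: [set prod_perm (1, s) | s in A2]>>.
Proof.
rewrite -(dprodWY (setX_dprod <<A1>>%G <<A2>>%G)) /=.
rewrite -morphim_pairg1 -morphim_pair1g.
rewrite [_ @* <<A1>>]morphim_gen ?subsetT // [_ @* <<A2>>]morphim_gen ?subsetT //.
rewrite joing_idl joing_idr morphim_gen ?subsetT // morphimU.
congr <<_ :|: _>>; rewrite !morphimEsub ?subsetT // -imset_comp; exact: eq_imset.
Qed.
End DirectProduct.

Lemma antichainP d (P : finPOrderType d) (A : {set P}) :
  reflect {in A &, forall x y, (x <= y)%O -> x = y} (A \in antichains P).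
Proof.
rewrite inE; apply: (iffP forall_inP) => [H x y xA yA xy|H x xA].
  apply/eqP; have /forall_inP/(_ y yA) := H x xA.
  by rewrite /Order.comparable xy /= implybF negbK.
apply/forall_inP=> y yA; apply/implyP; apply: contra_neqN => /orP[].
  exact: H.
by move/(H _ _ yA xA).
Qed.

(** * Antichains of a disjoint union *)

Section ToggleDisjointUnion.
Variables (d d1 d2 : Order.disp_t) (P : finPOrderType d).
Variables (P1 : finPOrderType d1) (P2 : finPOrderType d2).
Variables (phi : P -> dunion P1 P2) (phi' : dunion P1 P2 -> P).
Hypotheses (phiK : cancel phi phi') (phi'K : cancel phi' phi).
Hypothesis phi_mono : {mono phi : x y / (x <= y)%O}.
Implicit Types (A : {set P1}) (B : {set P2}).

Definition join_set A B : {set P} :=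
  [set x | match phi x with inl y => y \in A | inr y => y \in B end].

Lemma mem_join_setl A B y : (phi' (inl y) \in join_set A B) = (y \in A).
Proof. by rewrite inE phi'K. Qed.

Lemma mem_join_setr A B y : (phi' (inr y) \in join_set A B) = (y \in B).
Proof. by rewrite inE phi'K. Qed.

(** No condition links [A] and [B], because elements of different summands are incomparable. *)
Lemma antichains_join A B :
  (join_set A B \in antichains P) = (A \in antichains P1) && (B \in antichains P2).
Proof.
have le' u v : (phi' u <= phi' v)%O = (u <= v)%O by rewrite -phi_mono !phi'K.
apply/antichainP/andP => [H|[/antichainP HA /antichainP HB] x y].
  split; apply/antichainP=> x y xA yA xy.
    suff /(congr1 phi) : phi' (inl x) = phi' (inl y) by rewrite !phi'K => -[].
    by apply: H; rewrite ?mem_join_setl ?le'.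
  suff /(congr1 phi) : phi' (inr x) = phi' (inr y) by rewrite !phi'K => -[].
  by apply: H; rewrite ?mem_join_setr ?le'.
rewrite -[x]phiK -[y]phiK le'.
case: (phi x) (phi y) => x' [] y'; rewrite ?mem_join_setl ?mem_join_setr // => xA yA.
  by move/(HA _ _ xA yA)->.
by move/(HB _ _ xA yA)->.
Qed.

Lemma join_setU1l A B y : join_set (y |: A) B = phi' (inl y) |: join_set A B.
Proof.
apply/setP=> x; rewrite -[x]phiK; case: (phi x) => z.
  by rewrite !inE !phi'K (inj_eq (can_inj phi'K)) ?inE.
by rewrite !inE !phi'K (inj_eq (can_inj phi'K)) ?inE.
Qed.

Lemma join_setU1r A B y : join_set A (y |: B) = phi' (inr y) |: join_set A B.
Proof.
apply/setP=> x; rewrite -[x]phiK; case: (phi x) => z.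
  by rewrite !inE !phi'K (inj_eq (can_inj phi'K)) ?inE.
by rewrite !inE !phi'K (inj_eq (can_inj phi'K)) ?inE.
Qed.

Lemma join_setD1l A B y : join_set (A :\ y) B = join_set A B :\ phi' (inl y).
Proof.
apply/setP=> x; rewrite -[x]phiK; case: (phi x) => z.
  by rewrite !inE !phi'K (inj_eq (can_inj phi'K)) ?inE.
by rewrite !inE !phi'K (inj_eq (can_inj phi'K)) ?inE.
Qed.

Lemma join_setD1r A B y : join_set A (B :\ y) = join_set A B :\ phi' (inr y).
Proof.
apply/setP=> x; rewrite -[x]phiK; case: (phi x) => z.
  by rewrite !inE !phi'K (inj_eq (can_inj phi'K)) ?inE.
by rewrite !inE !phi'K (inj_eq (can_inj phi'K)) ?inE.
Qed.

Lemma toggle_set_joinl A B y : B \in antichains P2 ->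
  toggle_set (antichains P) (phi' (inl y)) (join_set A B) =
    join_set (toggle_set (antichains P1) y A) B.
Proof.
move=> BP; rewrite /toggle_set mem_join_setl -join_setU1l -join_setD1l.
by rewrite !antichains_join BP !andbT; do 2?case: ifP => _.
Qed.

Lemma toggle_set_joinr A B y : A \in antichains P1 ->
  toggle_set (antichains P) (phi' (inr y)) (join_set A B) =
    join_set A (toggle_set (antichains P2) y B).
Proof.
move=> AP; rewrite /toggle_set mem_join_setr -join_setU1r -join_setD1r.
by rewrite !antichains_join AP /=; do 2?case: ifP => _.
Qed.

Local Notation members L := {X : {set _} | X \in L}.

Fact join_memP (X : members (antichains P1) * members (antichains P2)) :
  join_set (val X.1) (val X.2) \in antichains P.
Proof. by rewrite antichains_join (valP X.1) (valP X.2). Qed.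

Definition join_mem X : members (antichains P) :=
  exist _ (join_set (val X.1) (val X.2)) (join_memP X).

Lemma join_set_preim (X : {set P}) :
  join_set [set y | phi' (inl y) \in X] [set y | phi' (inr y) \in X] = X.
Proof.
by apply/setP=> x; rewrite -[x]phiK inE phi'K; case: (phi x) => y; rewrite inE.
Qed.

Fact split_memP (X : members (antichains P)) :
  ([set y | phi' (inl y) \in val X] \in antichains P1) &&
  ([set y | phi' (inr y) \in val X] \in antichains P2).
Proof. by rewrite -antichains_join join_set_preim (valP X). Qed.

Definition split_mem (X : members (antichains P)) :
    members (antichains P1) * members (antichains P2) :=
  (exist _ [set y | phi' (inl y) \in val X] (proj1 (andP (split_memP X))),
   exist _ [set y | phi' (inr y) \in val X] (proj2 (andP (split_memP X)))).

Lemma join_memK : cancel join_mem split_mem.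
Proof.
move=> [A B]; congr (_, _); apply/val_inj/setP=> x; rewrite inE.
  by rewrite mem_join_setl.
by rewrite mem_join_setr.
Qed.

Lemma split_memK : cancel split_mem join_mem.
Proof. by move=> X; apply/val_inj/join_set_preim. Qed.

(** The product action is transported to antichains of [P] by [join_mem]. It is injective and
    matches generators with generators: a toggle paired with the identity becomes the toggle of the
    corresponding element of [P]. *)
Lemma toggle_group_disjoint_union :
  toggle_group (antichains P) \isog
    setX (toggle_group (antichains P1)) (toggle_group (antichains P2)).
Proof.
pose psi := prod_perm_morphism join_memK split_memK.
(* The empty antichain provides the base points that injectivity requires. *)
have mem0 d' (Q : finPOrderType d') : set0 \in antichains Q.
  by apply/antichainP=> x y; rewrite inE.
have injpsi := injm_prod_perm join_memK split_memK
  (exist _ set0 (mem0 _ P1)) (exist _ set0 (mem0 _ P2)).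
suff psiT : (psi @* setX (toggle_group (antichains P1))
                         (toggle_group (antichains P2)) = toggle_group (antichains P))%g.
  by rewrite isog_sym -psiT sub_isog ?subsetT.
rewrite prod_perm_gen; congr <<_>>%g.
have psil e :
    prod_perm join_memK split_memK (toggle _ e, 1%g) = toggle _ (phi' (inl e)).
  apply/permP=> x; rewrite -[x]split_memK; case: (split_mem x) => A B.
  apply: val_inj; rewrite prod_permE !val_toggle /= toggle_set_joinl ?(valP B) //.
  by rewrite perm1 val_toggle.
have psir e :
    prod_perm join_memK split_memK (1%g, toggle _ e) = toggle _ (phi' (inr e)).
  apply/permP=> x; rewrite -[x]split_memK; case: (split_mem x) => A B.
  apply: val_inj; rewrite prod_permE !val_toggle /= toggle_set_joinr ?(valP A) //.
  by rewrite perm1 val_toggle.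
apply/setP=> s; rewrite in_setU; apply/orP/imsetP.
  case=> [] /imsetP[_ /imsetP[e _ ->] ->].
    by exists (phi' (inl e)); rewrite ?psil.
  by exists (phi' (inr e)); rewrite ?psir.
case=> e _ ->; rewrite -[e]phiK; case: (phi e) => e'; [left | right].
  by rewrite -psil; do 2!apply: imset_f.
by rewrite -psir; do 2!apply: imset_f.
Qed.

End ToggleDisjointUnion.

(** * Induced subposets and the final assembly *)

Section SubPoset.
Variables (d : Order.disp_t) (P : finPOrderType d) (V : {set P}).

Definition sub_poset := {x : P | x \in V}.
HB.instance Definition _ := SubFinite.on sub_poset.
HB.instance Definition _ := [SubChoice_isSubPOrder of sub_poset by <: with d].

End SubPoset.

Lemma is_disjoint_union_sub d (P : finPOrderType d) (V : {set P}) :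
    {in V & ~: V, forall x y, (x >< y)%O} ->
  is_disjoint_union P (sub_poset V) (sub_poset (~: V)).
Proof.
move=> incV.
have VC x : ~ x \in V -> x \in ~: V by rewrite inE => /negP.
(* Matching on [idP] keeps the membership proof needed to build an element of the subtype. *)
pose f x : dunion (sub_poset V) (sub_poset (~: V)) :=
  match @idP (x \in V) with
  | ReflectT h => inl (exist _ x h)
  | ReflectF h => inr (exist _ x (VC x h))
  end.
pose g (u : dunion (sub_poset V) (sub_poset (~: V))) : P :=
  match u with inl x => val x | inr x => val x end.
have fK : cancel f g by move=> x; rewrite /f; case: {-}_ / idP.
have gK : cancel g f.
  case=> [] [x xV]; rewrite /f /=; case: {-}_ / idP => h.
  - by congr inl; apply: val_inj.
  - by case: h.
  - by have := xV; rewrite inE h.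
  by congr inr; apply: val_inj.
exists f; split; first by exists g.
move=> x y; rewrite -[in RHS](fK x) -[in RHS](fK y).
case: (f x) (f y) => [x'|x'] [y'|y'] //=; apply/esym/negbTE.
  by have := incV _ _ (valP x') (valP y'); rewrite negb_or => /andP[].
by have := incV _ _ (valP y') (valP x'); rewrite negb_or => /andP[].
Qed.

Theorem corollary3p13 (d : Order.disp_t) (P : finPOrderType d) :
  (forall (d1 d2 : Order.disp_t)
      (P1 : finPOrderType d1) (P2 : finPOrderType d2),
    is_disjoint_union P P1 P2 ->
    toggle_group (antichains P) \isog
      setX (toggle_group (antichains P1)) (toggle_group (antichains P2)))
  /\
  (~ (exists (d1 d2 : Order.disp_t)
        (P1 : finPOrderType d1) (P2 : finPOrderType d2),
      [/\ 0 < #|P1|, 0 < #|P2| & is_disjoint_union P P1 P2]) ->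
    toggle_alternating (antichains P)).
Proof.
split=> [d1 d2 P1 P2 [f [[g fK gK] fmono]]|nU].
  exact: (toggle_group_disjoint_union fK gK fmono).
pose r := [rel x y : P | (x != y) && (x >=< y)%O].
have r_sym : symmetric r.
  by move=> x y; rewrite /= eq_sym Order.POrderTheory.comparable_sym.
have r_irr : irreflexive r by move=> x; rewrite /= eqxx.
have -> : antichains P = indep r setT.
  apply/setP=> A; rewrite !inE subsetT; apply: eq_forallb => x.
  by case: (x \in A) => //; apply: eq_forallb => y; rewrite negb_and -implybE.
(* If no comparability leaves [V], then [V] and its complement split [P] into two nonempty summands,
   contradicting [nU]. *)
apply: toggle_alternating_connected => // V /set0Pn[x xV] VT.
have [/exists_inP[w wV /exists_inP[v vV wv]]|] :=
    boolP [exists w in V, exists v in ~: V, r w v].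
  by exists w, v; rewrite inE in vV.
rewrite negb_exists_in => /forall_inP nr; case: nU.
have /set0Pn[y yV] : ~: V != set0 by rewrite -setCT (inj_eq (@setC_inj _)).
exists d, d, (sub_poset V), (sub_poset (~: V)); split.
- by apply/card_gt0P; exists (exist _ x xV).
- by apply/card_gt0P; exists (exist _ y yV).
apply: is_disjoint_union_sub => w v wV vV.
have := nr w wV; rewrite negb_exists_in => /forall_inP/(_ v vV).
rewrite negb_and negbK => /orP[/eqP wv|//].
by move: vV; rewrite -wv inE wV.
Qed.
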